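(* The upper Minkowski dimension $\dim_{M^*}$ is not product-summable, and the Hausdorff dimension $\dim_H$ is not product-summable.
   Context: Let $f$ be a function defined for all nonempty bounded subsets of $\mathbb{R}^k$ for all $k\ge1$. Then $f$ is product-summable if $f(A)+f(B)=f(A\times B)$ for all nonempty bounded sets $A\subset\mathbb{R}^m$ and $B\subset\mathbb{R}^n$ (and all $m,n\ge1$), where $A\times B\subset\mathbb{R}^{m+n}$ is the Cartesian product. For a nonempty bounded set $A\subset\mathbb{R}^n$ and $\varepsilon>0$, $N_A(\varepsilon)$ is the minimum number of (closed, axis-parallel) cubes of side length $\varepsilon$ in $\mathbb{R}^n$ needed to cover $A$, and the upper Minkowski dimension is $\dim_{M^*}(A)=\limsup_{\varepsilon\to0^+}\frac{\log N_A(\varepsilon)}{\log(1/\varepsilon)}$. $\dim_H$ denotes the usual Hausdorff dimension. *)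

(* Defs.v *)
From HB Require Import structures.
From mathcomp Require Import all_boot all_order all_algebra.
From mathcomp Require Import all_classical all_reals all_analysis.

Set Implicit Arguments.
Unset Strict Implicit.
Unset Printing Implicit Defensive.

Import Order.TTheory GRing.Theory Num.Theory.
Import numFieldNormedType.Exports.

Local Open Scope classical_set_scope.
Local Open Scope ring_scope.

Definition cartesian_product (R : realType) (m n : nat)
    (A : set 'rV[R]_m) (B : set 'rV[R]_n) : set 'rV[R]_(m + n) :=
  [set row_mx a b | a in A & b in B].

(* A set function is total here, but only its values on nonempty bounded
   subsets of R^k with k >= 1 matter. [bounded_set] refers to the sup norm,
   which has the same bounded sets as the Euclidean norm. *)
Definition product_summable (R : realType)
    (f : forall k : nat, set 'rV[R]_k -> \bar R) : Prop :=
  forall (m n : nat) (A : set 'rV[R]_m) (B : set 'rV[R]_n),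
    (0 < m)%N -> (0 < n)%N ->
    A !=set0 -> bounded_set A -> B !=set0 -> bounded_set B ->
    (f m A + f n B = f (m + n)%N (cartesian_product A B))%E.

Definition cube (R : realType) (k : nat) (c : 'rV[R]_k) (e : R) : set 'rV[R]_k :=
  [set x | forall j : 'I_k, c 0 j <= x 0 j <= c 0 j + e].

Definition covered_by_cubes (R : realType) (k : nat) (A : set 'rV[R]_k)
    (e : R) (N : nat) : Prop :=
  exists c : 'I_N -> 'rV[R]_k, A `<=` [set x | exists i, cube (c i) e x].

(* The minimum exists when A is bounded and 0 < e; otherwise the value may be
   the default 0. *)
Definition covering_number (R : realType) (k : nat) (A : set 'rV[R]_k)
    (e : R) : nat :=
  xget 0%N [set N | covered_by_cubes A e N /\
                    forall N', covered_by_cubes A e N' -> (N <= N')%N].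

Definition upper_minkowski_dim (R : realType) (k : nat) (A : set 'rV[R]_k) :
    \bar R :=
  limf_esup (fun e : R => (ln (covering_number A e)%:R / ln (1 / e))%:E)
            (0 : R)^'+.

(* The library norm on 'rV[R]_k is the sup norm, hence an explicit Euclidean
   distance. *)
Definition euclidean_dist (R : realType) (k : nat) (x y : 'rV[R]_k) : R :=
  Num.sqrt (\sum_(j < k) (x 0 j - y 0 j) ^+ 2).

(* Only meaningful on nonempty sets: it is -oo on set0. *)
Definition diam (R : realType) (k : nat) (U : set 'rV[R]_k) : \bar R :=
  ereal_sup [set (euclidean_dist x y)%:E | x in U & y in U].

(* diam(U)^s, with the conventions 0^0 = 1 on nonempty sets and value 0 on the
   empty set, so that s = 0 gives the counting measure and finite covers may be
   padded with empty sets. *)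
Definition diam_pow (R : realType) (k : nat) (s : R) (U : set 'rV[R]_k) :
    \bar R :=
  if `[< U = set0 >] then 0%E else poweR (diam U) s.

Definition hausdorff_premeasure (R : realType) (k : nat) (s delta : R)
    (A : set 'rV[R]_k) : \bar R :=
  ereal_inf [set (\sum_(0 <= i <oo) diam_pow s (U i))%E
            | U in [set U : nat -> set 'rV[R]_k |
                     A `<=` \bigcup_i U i /\
                     forall i, (diam (U i) <= delta%:E)%E]].

(* The limit as delta -> 0+ is a supremum, the premeasure being nonincreasing
   in delta. *)
Definition hausdorff_measure (R : realType) (k : nat) (s : R)
    (A : set 'rV[R]_k) : \bar R :=
  ereal_sup [set hausdorff_premeasure s delta A
            | delta in [set delta : R | 0 < delta]].

Definition hausdorff_dim (R : realType) (k : nat) (A : set 'rV[R]_k) : \bar R :=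
  ereal_inf [set s%:E
            | s in [set s : R | 0 <= s /\ hausdorff_measure s A = 0%E]].

(* Main.v *)
Require Import Defs.
From mathcomp Require Import all_boot all_order all_algebra.
From mathcomp Require Import all_classical all_reals all_analysis.
From mathcomp Require Import ring lra.

(** One pair of sets refutes both claims. Split the positions of binary digits
into blocks [8^j, 8^(j+1)[; let A (resp. B) be the numbers of [0, 1] whose
binary digits vanish outside the odd (resp. even) blocks. Splitting the digits
of a real number shows that A + B contains [0, 1[. At level 2^-n, A is covered
by as many intervals as there are words on the n first digits that are free in
A, and infinitely often only n/8 of these are free; likewise for B.
- Hausdorff: these sparse levels give dim A, dim B <= 1/4, while the Lipschitz
  map (x, y) |-> x + y sends A x B onto a set containing [0, 1[, so that
  dim (A x B) >= 1.
- Minkowski: A x B is covered by 2^n squares of side 2^-n, so its dimension is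
  at most 1 (5/4 suffices); but the map to [0, 1[ also forces
  N_A(2^-n) N_B(2^-n) >= 2^(n-1), so A needs about 2^(7n/8) intervals at the
  levels where B is sparse, and conversely: both dimensions are >= 3/4. *)

Set Implicit Arguments.
Unset Strict Implicit.
Unset Printing Implicit Defensive.

Import Order.TTheory GRing.Theory Num.Theory.
Import numFieldNormedType.Exports.

Local Open Scope classical_set_scope.
Local Open Scope ring_scope.

(** * Counting free digit positions; sparse sets of positions *)

Definition count_below (S : pred nat) (n : nat) : nat := (\sum_(i < n) S i)%N.

Lemma count_below_predC (S : pred nat) n :
  (count_below S n + count_below (predC S) n = n)%N.
Proof.
rewrite /count_below -big_split /= (eq_bigr (fun=> 1%N)) ?sum1_card ?card_ord//.
by move=> i _; case: (S i).
Qed.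

Lemma count_below_gap (S : pred nat) m n : (m <= n)%N ->
  (forall i, (m <= i < n)%N -> ~~ S i) -> (count_below S n <= m)%N.
Proof.
move=> mn gap; rewrite /count_below -(big_mkord xpredT (fun i => S i : nat)).
rewrite (big_cat_nat (leq0n m) mn)/= [X in (_ + X)%N]big_nat_cond [X in (_ + X)%N]big1.
  rewrite addn0 big_mkord -[leqRHS]card_ord -sum1_card leq_sum// => i _.
  by case: (S i).
by move=> i /andP[/gap/negbTE ->].
Qed.

Definition sparse (S : pred nat) : Prop :=
  forall N, exists2 k, (N <= k)%N & (count_below S (8 * k) <= k)%N.

(** The block containing [i] has index [trunc_log 8 i]; position 0 gets index 0 by the default value
    of [trunc_log]. *)
Definition odd_blocks : pred nat := fun i => odd (trunc_log 8 i).

(** A block [8^j, 8^(j+1)[ whose index has parity [b] contains no counted position, so with k = 8^j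
    every counted position below 8k already lies below k. *)
Lemma sparse_parity_blocks (b : bool) :
  sparse (fun i => odd (trunc_log 8 i) != b).
Proof.
move=> N; pose j := (b + N.*2)%N; exists (8 ^ j)%N.
  apply: leq_trans (ltnW (ltn_expl j (isT : 1 < 8)%N)).
  by rewrite /j -addnn addnA leq_addl.
rewrite -expnS; apply: count_below_gap; first by rewrite leq_exp2l.
move=> i /(@trunc_log_eq 8 j i isT) ->.
by rewrite /j oddD odd_double addbF oddb eqxx.
Qed.

Lemma sparse_odd_blocks : sparse odd_blocks.
Proof.
move=> N; have [k Nk ck] := sparse_parity_blocks false N.
exists k => //; apply: leq_trans ck; apply: leq_sum => i _.
by rewrite /odd_blocks; case: (odd _).
Qed.

Lemma sparse_even_blocks : sparse (predC odd_blocks).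
Proof.
move=> N; have [k Nk ck] := sparse_parity_blocks true N.
exists k => //; apply: leq_trans ck; apply: leq_sum => i _ /=.
by rewrite /odd_blocks; case: (odd _).
Qed.

(** * Binary expansions of real numbers and splitting of digits *)

Section BinaryExpansion.
Variable R : realType.
Implicit Types (d : nat -> bool) (S : pred nat).

Definition binary_prefix d n : R := \sum_(i < n) (d i)%:R / 2 ^+ i.+1.

(** The prefixes are nondecreasing and bounded, so this supremum is the sum of the binary series. *)
Definition binary_value d : R := sup (range (binary_prefix d)).

Lemma binary_prefixS d n :
  binary_prefix d n.+1 = binary_prefix d n + (d n)%:R / 2 ^+ n.+1.
Proof. by rewrite /binary_prefix big_ord_recr. Qed.

Lemma half_pow n : 1 / 2 ^+ n = 2 * (1 / 2 ^+ n.+1) :> R.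
Proof. by rewrite exprS; field; rewrite expf_neq0. Qed.

Lemma half_pow_gt0 n : 0 < 1 / 2 ^+ n :> R.
Proof. by rewrite divr_gt0// exprn_gt0. Qed.

(** The intervals from a prefix to that prefix plus 2^-n are nested: each digit selects one half of
    the previous interval. *)
Lemma binary_prefix_bounds d m n : (m <= n)%N ->
  binary_prefix d m <= binary_prefix d n /\
  binary_prefix d n + 1 / 2 ^+ n <= binary_prefix d m + 1 / 2 ^+ m.
Proof.
elim: n => [|n IHn]; first by rewrite leqn0 => /eqP ->; split.
rewrite leq_eqVlt => /orP[/eqP -> //|/IHn[h1 h2]].
rewrite binary_prefixS; have := half_pow n; have := half_pow_gt0 n.+1.
by case: (d n) => /= ? ?; split; lra.
Qed.

Lemma binary_value_bounds d n :
  binary_prefix d n <= binary_value d <= binary_prefix d n + 1 / 2 ^+ n.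
Proof.
have ub m : binary_prefix d m <= binary_prefix d n + 1 / 2 ^+ n.
  have [/(binary_prefix_bounds d)[h1 h2]|/ltnW/(binary_prefix_bounds d)[h1 h2]] :=
    leqP n m; have := half_pow_gt0 n; have := half_pow_gt0 m; lra.
apply/andP; split.
  apply: ub_le_sup; last by exists n.
  by exists (binary_prefix d n + 1 / 2 ^+ n) => _ [m _ <-].
apply: ge_sup; first by exists (binary_prefix d 0); exists 0%N.
by move=> _ [m _ <-].
Qed.

(** The factor 2 leaves room for the truncation errors of two expansions, as needed when digits are
    split. *)
Lemma eq_half_pow (x y : R) :
  (forall n, `|x - y| <= 2 * (1 / 2 ^+ n)) -> x = y.
Proof.
move=> xy; apply/eqP/negPn/negP; rewrite -subr_eq0 -normr_gt0 => xy0.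
set e := `|_| in xy0 xy.
(* This level n satisfies 2 / e < n < 2^n. *)
have := xy (Num.truncn (2 / e)).+1; rewrite leNgt => /negP; apply.
rewrite mulrA mulr1 ltr_pdivrMr ?exprn_gt0// mulrC -ltr_pdivrMr//.
apply: lt_le_trans (truncnS_gt _) _.
by rewrite -natrX ler_nat ltnW// ltn_expl.
Qed.

Lemma binary_value_uniq d (x : R) :
  (forall n, binary_prefix d n <= x <= binary_prefix d n + 1 / 2 ^+ n) ->
  binary_value d = x.
Proof.
move=> dx; apply: eq_half_pow => n.
have /andP[? ?] := binary_value_bounds d n; have /andP[? ?] := dx n.
by have := half_pow_gt0 n; rewrite ler_norml => ?; apply/andP; split; lra.
Qed.

Definition binary_digit (x : R) (i : nat) : bool := odd (Num.truncn (2 ^+ i.+1 * x)).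

(** Doubling the integer part of 2^n x and adding the next digit gives the integer part of 2^(n+1)
    x; x < 1 makes the induction start at 0. *)
Lemma binary_prefix_digit (x : R) n : 0 <= x < 1 ->
  binary_prefix (binary_digit x) n = (Num.truncn (2 ^+ n * x))%:R / 2 ^+ n.
Proof.
move=> /andP[x0 x1]; elim: n => [|n IHn].
  rewrite /binary_prefix big_ord0 expr0 mul1r.
  suff -> : Num.truncn x = 0%N by rewrite mul0r.
  by apply: truncn_def; rewrite x0 x1.
rewrite binary_prefixS {}IHn /binary_digit.
set m := Num.truncn (2 ^+ n.+1 * x).
have -> : Num.truncn (2 ^+ n * x) = m./2.
  have /truncn_itv : 0 <= 2 ^+ n.+1 * x by rewrite mulr_ge0// exprn_ge0.
  rewrite -/m => /andP[m1 m2]; apply: truncn_def.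
  rewrite exprS in m1 m2.
  have h : (m = odd m + m./2 * 2)%N by rewrite muln2 odd_double_half.
  have hm : m%:R = (odd m)%:R + m./2%:R * 2 :> R by rewrite {1}h natrD natrM.
  move: m1 m2; rewrite -[m.+1%:R]natr1 -[m./2.+1%:R]natr1 hm; move: (m./2%:R : R) (2 ^+ n : R) => u v.
  by case: (odd m) => /= ? ?; apply/andP; split; lra.
rewrite -[in RHS](odd_double_half m) -muln2 natrD natrM exprS.
by field; rewrite expf_neq0.
Qed.

Lemma binary_value_digit (x : R) : 0 <= x < 1 ->
  binary_value (binary_digit x) = x.
Proof.
move=> x01; apply: binary_value_uniq => n; rewrite binary_prefix_digit//.
have /andP[x0 x1] := x01.
have /truncn_itv /andP[h1 h2] : 0 <= 2 ^+ n * x by rewrite mulr_ge0// exprn_ge0.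
by rewrite -mulrDl ler_pdivrMr ?ler_pdivlMr ?exprn_gt0// [x * _]mulrC h1 natr1 ltW.
Qed.

Definition restrict_digits S d : nat -> bool := fun i => S i && d i.

(** The two restricted words are never both 1 at one position, so prefixes add without carries. *)
Lemma binary_value_split S d :
  binary_value d = binary_value (restrict_digits S d) +
                   binary_value (restrict_digits (predC S) d).
Proof.
have prefix_split n : binary_prefix d n =
    binary_prefix (restrict_digits S d) n +
    binary_prefix (restrict_digits (predC S) d) n.
  rewrite /binary_prefix -big_split; apply: eq_bigr => i _ /=.
  by rewrite -mulrDl -natrD /restrict_digits /=; case: (S i); rewrite ?addn0.
apply: eq_half_pow => n; have := prefix_split n.
have /andP[? ?] := binary_value_bounds d n.
have /andP[? ?] := binary_value_bounds (restrict_digits S d) n.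
have /andP[? ?] := binary_value_bounds (restrict_digits (predC S) d) n.
by move=> ?; rewrite ler_norml; apply/andP; split; lra.
Qed.
End BinaryExpansion.

(** * Coverings by intervals and by cubes *)

Section Coverings.
Variable R : realType.

Lemma nneseries_zero_tail (f : nat -> \bar R) N : (forall i, 0 <= f i)%E ->
  (forall i, (N <= i)%N -> f i = 0%E) ->
  (\sum_(0 <= i <oo) f i = \sum_(i < N) f i)%E.
Proof.
move=> f0 fN; rewrite (nneseries_split 0 N)// add0n big_mkord.
by rewrite eseries0 ?adde0// => i iN _; exact: fN.
Qed.

(** Countable subadditivity of Lebesgue measure, applied to the enclosing intervals because the
    [F i] need not be measurable. *)
Lemma unit_interval_cover (F : nat -> set R) (l : nat -> R) :
  (forall i, 0 <= l i) -> (forall i, exists a, F i `<=` `[a, a + l i]) ->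
  `[0, 1[ `<=` \bigcup_i F i -> (1 <= \sum_(0 <= i <oo) (l i)%:E)%E.
Proof.
move=> l0 /choice[a Fa] F01.
have <- : lebesgue_measure (`[0, 1[%classic : set R) = 1%E.
  by rewrite lebesgue_measure_itv /= lte_fin ltr01 oppr0 adde0.
have FU : `[0, 1[ `<=` \bigcup_i `[a i, a i + l i]%classic.
  by apply: subset_trans F01 _; apply: subset_bigcup => i _; exact: Fa.
have h := @measure_sigma_subadditive _ _ _ (@lebesgue_measure R) _ _ _ _ FU.
apply: le_trans (h _ _ ) _ => //.
apply: lee_nneseries => // i _; rewrite [leLHS]lebesgue_measure_itv /= lte_fin.
by case: ifP => _; rewrite lee_fin// addrC addKr.
Qed.

Lemma covered_by_finite_family (k : nat) (A : set 'rV[R]_k) (e : R)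
    (I : finType) (c : I -> 'rV[R]_k) :
  A `<=` [set x | exists i, cube (c i) e x] -> covered_by_cubes A e #|I|.
Proof.
move=> Ac; exists (c \o enum_val) => x /Ac[i ci].
by exists (enum_rank i); rewrite /= enum_rankK.
Qed.

Lemma covered_by_cubes_product (m n : nat) (A : set 'rV[R]_m) (B : set 'rV[R]_n)
    (e : R) (M N : nat) :
  covered_by_cubes A e M -> covered_by_cubes B e N ->
  covered_by_cubes (cartesian_product A B) e (M * N).
Proof.
move=> [c Ac] [c' Bc].
have -> : (M * N)%N = #|{: 'I_M * 'I_N}| by rewrite card_prod !card_ord.
apply: (@covered_by_finite_family _ _ _ _ (fun ij => row_mx (c ij.1) (c' ij.2))).
move=> _ [a Aa] [b Bb] <-.
have [i ci] := Ac _ Aa; have [i' ci'] := Bc _ Bb.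
exists (i, i') => j /=; rewrite !mxE.
by case: (fintype.split j) => j'; [exact: ci|exact: ci'].
Qed.

Lemma covered_by_cubes_le (k : nat) (A : set 'rV[R]_k) (e e' : R) (N : nat) :
  e <= e' -> covered_by_cubes A e N -> covered_by_cubes A e' N.
Proof.
move=> ee' [c Ac]; exists c => x /Ac[i ci]; exists i => j.
by have /andP[-> /le_trans ->] := ci j; rewrite ?lerD2l.
Qed.

(** One existing cover rules out the default value 0 of [xget]. *)
Lemma covering_numberP (k : nat) (A : set 'rV[R]_k) (e : R) (N : nat) :
  covered_by_cubes A e N ->
  covered_by_cubes A e (covering_number A e) /\ (covering_number A e <= N)%N.
Proof.
move=> AN; rewrite /covering_number; case: xgetP => [M _ [AM +]|none].
  by move=> /(_ _ AN).
have exN : exists n, `[< covered_by_cubes A e n >] by exists N; apply/asboolP.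
case: (ex_minnP exN) => m /asboolP Am min_m.
by have := none m; case; split => // n An; apply/min_m/asboolP.
Qed.
End Coverings.

(** * Digit sets, their covers, and the sum map on their product *)

Section DigitSets.
Variable R : realType.
Implicit Types S : pred nat.

Definition digit_set S : set 'rV[R]_1 :=
  [set const_mx (binary_value R (restrict_digits S d)) | d in setT].

Lemma digit_set_neq0 S : digit_set S !=set0.
Proof. by eexists; exists (fun=> true). Qed.

Lemma bounded_digit_set S : bounded_set (digit_set S).
Proof.
exists 1; split; first exact: num_real.
move=> M M1 _ [d _ <-]; apply: le_trans (ltW M1).
rewrite /Num.norm /= mx_normrE; apply/bigmax_leP; split => // ij _; rewrite mxE.
have := binary_value_bounds R (restrict_digits S d) 0.
by rewrite /binary_prefix big_ord0 ler_norml => /andP[? ?]; apply/andP; split; lra.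
Qed.

(** A list suffices: its length bounds the number of intervals in a cover, whether or not values
    repeat. *)
Fixpoint prefix_values S n : seq R :=
  if n is m.+1 then
    if S m then prefix_values S m ++ [seq x + 1 / 2 ^+ n | x <- prefix_values S m]
    else prefix_values S m
  else [:: 0].

Lemma size_prefix_values S n : size (prefix_values S n) = (2 ^ count_below S n)%N.
Proof.
elim: n => [|n IHn]; first by rewrite /count_below big_ord0.
rewrite /count_below big_ord_recr /= -/(count_below S n).
case: (S n); rewrite ?addn0 ?addn1// size_cat size_map IHn expnS.
by rewrite mul2n addnn.
Qed.

Lemma mem_prefix_values S d n :
  binary_prefix R (restrict_digits S d) n \in prefix_values S n.
Proof.
elim: n => [|n IHn]; first by rewrite /binary_prefix big_ord0 mem_head.
rewrite binary_prefixS /= {2}/restrict_digits; case: (S n) => /=; last first.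
  by rewrite mul0r addr0.
case: (d n); rewrite mem_cat; last by rewrite mul0r addr0 IHn.
by apply/orP; right; exact: (map_f (fun x => x + 1 / 2 ^+ n.+1) IHn).
Qed.

Lemma digit_set_covered S n :
  covered_by_cubes (digit_set S) (1 / 2 ^+ n) (2 ^ count_below S n).
Proof.
rewrite -size_prefix_values.
exists (fun i => const_mx (prefix_values S n)`_i) => _ [d _ <-].
have /(nthP 0)[i iN e] := mem_prefix_values S d n.
by exists (Ordinal iN) => j; rewrite !mxE /= e; exact: binary_value_bounds.
Qed.

Definition coord_sum (z : 'rV[R]_(1 + 1)) : R :=
  z 0 (lshift 1 ord0) + z 0 (rshift 1 ord0).

Lemma coord_sum_digit_product S (x : R) : 0 <= x < 1 ->
  exists2 z, cartesian_product (digit_set S) (digit_set (predC S)) z &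
             coord_sum z = x.
Proof.
move=> x01; pose a S' : 'rV[R]_1 :=
  const_mx (binary_value R (restrict_digits S' (binary_digit x))).
exists (row_mx (a S) (a (predC S))).
  by exists (a S); [|exists (a (predC S))] => //; exists (binary_digit x).
by rewrite /coord_sum row_mxEl row_mxEr !mxE -binary_value_split binary_value_digit.
Qed.

(** Common source of both lower bounds: a cover of the product is carried by [coord_sum] to a cover
    of [0, 1[. *)
Lemma digit_product_cover_ge1 S (U : nat -> set 'rV[R]_(1 + 1)) (l : nat -> R) :
  (forall i, 0 <= l i) ->
  (forall i, exists a, coord_sum @` U i `<=` `[a, a + l i]) ->
  cartesian_product (digit_set S) (digit_set (predC S)) `<=` \bigcup_i U i ->
  (1 <= \sum_(0 <= i <oo) (l i)%:E)%E.
Proof.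
move=> l0 Ua cU; apply: unit_interval_cover l0 Ua _ => x /=.
rewrite in_itv /= => /(coord_sum_digit_product S)[z /cU[i _ Uz] <-].
by exists i => //; exists z.
Qed.

(** [coord_sum] sends a square of side e into an interval of length 2e; the finite cover is padded
    with empty sets of length 0. *)
Lemma covered_digit_product_ge S (e : R) (N : nat) : 0 <= e ->
  covered_by_cubes (cartesian_product (digit_set S) (digit_set (predC S))) e N ->
  1 <= N%:R * (2 * e).
Proof.
move=> e0 [c cU].
pose U i := oapp (fun j : 'I_N => cube (c j) e) set0 (insub i).
pose l i : R := if (i < N)%N then 2 * e else 0.
have l0 i : 0 <= l i by rewrite /l; case: ifP => // _; rewrite mulr_ge0.
have := @digit_product_cover_ge1 S U l l0.
rewrite (@nneseries_zero_tail _ _ N); first last.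
- by move=> i; rewrite /l ltnNge => ->.
- by move=> i; rewrite lee_fin.
rewrite (eq_bigr (fun=> (2 * e)%:E)); last by move=> i _; rewrite /l ltn_ord.
rewrite sumEFin sumr_const card_ord lee_fin -[_ *+ N]mulr_natl; apply.
- move=> i; rewrite /U /l; case: insubP => [j -> _|]/=.
    exists (coord_sum (c j)) => _ [z zj <-] /=; rewrite in_itv /= /coord_sum.
    have /andP[? ?] := zj (lshift 1 ord0); have /andP[? ?] := zj (rshift 1 ord0).
    by apply/andP; split; lra.
  by exists 0 => _ [z []].
by move=> z /cU[i zi]; exists i => //; rewrite /U valK.
Qed.
End DigitSets.
Arguments digit_set : clear implicits.

Lemma sparse_large (S : pred nat) (R : realType) (r : R) : sparse S -> 0 < r ->
  exists k, [/\ (0 < k)%N, 1 / 2 ^+ k < r & (count_below S (8 * k) <= k)%N].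
Proof.
move=> sS r0; have [k Nk ck] := sS (Num.truncn (1 / r)).+1.
exists k; split => //; first exact: leq_trans Nk.
rewrite ltr_pdivrMr ?exprn_gt0// mulrC -ltr_pdivrMr//.
apply: lt_le_trans (truncnS_gt _) _.
by rewrite -natrX ler_nat (leq_trans Nk)// ltnW// ltn_expl.
Qed.

(** * Bounds on the upper Minkowski dimension *)

Section MinkowskiDimension.
Variable R : realType.
Implicit Types S : pred nat.

Lemma half_pow_le m n : (m <= n)%N -> 1 / 2 ^+ n <= 1 / 2 ^+ m :> R.
Proof.
by move=> mn; rewrite !div1r lef_pV2 ?posrE ?exprn_gt0// ler_weXn2l// ler1n.
Qed.

Lemma ln2_gt0 : 0 < ln 2 :> R.
Proof. by rewrite ln_gt0// ltr1n. Qed.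

(** At scale 2^-8k the complementary set needs at most 2^k intervals, so N 2^k >= 2^(8k-1). The
    quotient of logarithms is then at least (7k-1)/8k, which is at least 3/4 since k >= 1. *)
Lemma upper_minkowski_dim_digit_set_ge S : sparse (predC S) ->
  ((3 / 4)%:E <= upper_minkowski_dim (digit_set R S))%E.
Proof.
move=> sS; apply: le_ereal_inf_tmp => _ [V V0 <-].
have [r /= r0 rV] : \forall r \near 0^'+, V r by [].
have [k [k0 kr ck]] := sparse_large sS r0.
pose e : R := 1 / 2 ^+ (8 * k).
have e0 : 0 < e by exact: half_pow_gt0.
apply: le_ereal_sup_tmp; eexists; first (exists e; last reflexivity).
  apply: rV => //=; rewrite sub0r normrN gtr0_norm//.
  by apply: le_lt_trans kr; apply: half_pow_le; rewrite leq_pmull.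
have [AN _] := covering_numberP (@digit_set_covered R S (8 * k)).
set N := covering_number _ _ in AN *.
have := covered_digit_product_ge (ltW e0)
  (covered_by_cubes_product AN (@digit_set_covered R (predC S) (8 * k))).
set c := count_below _ _ in ck *.
rewrite lee_fin natrM natrX => N_ge.
(* The exponent k+1 absorbs the factor 2 from the length of projected squares. *)
have {}N_ge : 2 ^+ (8 * k) <= N%:R * 2 ^+ k.+1 :> R.
  rewrite -[leLHS]mul1r -ler_pdivlMr ?exprn_gt0//; apply: le_trans N_ge _.
  rewrite /e div1r -!mulrA ler_wpM2l// mulrA -exprSr.
  rewrite ler_wpM2r ?invr_ge0 ?exprn_ge0//.
  by rewrite ler_weXn2l ?ler1n// ltnS.
have N0 : 0 < N%:R :> R.
  rewrite lt0r ler0n andbT; apply/eqP => N0; move: N_ge.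
  by rewrite N0 mul0r leNgt exprn_gt0.
have -> : ln (1 / e) = (8 * k)%:R * ln 2.
  by rewrite /e !div1r invrK lnXn// mulr_natl.
rewrite ler_pdivlMr ?mulr_gt0 ?ln2_gt0 ?ltr0n ?muln_gt0//.
move: N_ge; rewrite -ler_ln ?posrE ?mulr_gt0 ?exprn_gt0// lnM ?posrE ?exprn_gt0//.
rewrite !lnXn// -![ln 2 *+ _]mulr_natl natrM -[k.+1%:R]natr1.
have : ln 2 <= k%:R * ln 2 :> R by rewrite ler_peMl ?ler1n// ltW// ln2_gt0.
lra.
Qed.

(** If 2^-(n+1) <= e < 2^-n, then 2^(n+1) squares suffice, because the free positions of both
    factors below n+1 number n+1 in total. The quotient is at most (n+1)/n, hence at most 5/4 once n
    >= 4. *)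
Lemma upper_minkowski_dim_digit_product_le S :
  (upper_minkowski_dim
     (cartesian_product (digit_set R S) (digit_set R (predC S))) <=
   (5 / 4)%:E)%E.
Proof.
(* Restricting to e < 2^-4 is what forces n >= 4 below. *)
apply: ge_ereal_inf; exists (ereal_sup [set
  (ln (covering_number (cartesian_product (digit_set R S) (digit_set R (predC S)))
    e)%:R / ln (1 / e))%:E | e in [set e : R | 0 < e < 1 / 2 ^+ 4]]).
  eexists; last reflexivity.
  have h : 0 < 1 / 2 ^+ 4 :> R by exact: half_pow_gt0.
  near=> e; apply/andP; split; near: e; [exact: nbhs_right_gt|exact: nbhs_right_lt].
apply: ge_ereal_sup => _ [e /andP[e0 e4] <-]; rewrite lee_fin.
have ex_n : exists n, 1 / 2 ^+ n <= e.
  exists (Num.truncn (1 / e)).+1.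
  rewrite ler_pdivrMr ?exprn_gt0// mulrC -ler_pdivrMr//.
  apply: le_trans (ltW (truncnS_gt _)) _.
  by rewrite -natrX ler_nat ltnW// ltn_expl.
(* The least admissible level is written n+1; level 0 would give e >= 1. *)
have [[|n] en min_n] := ex_minnP ex_n.
  by move: e4; rewrite ltNge (le_trans (half_pow_le (isT : 0 <= 4)%N)).
have e_lt : e < 1 / 2 ^+ n.
  by rewrite ltNge; apply/negP => /min_n; rewrite ltnn.
have n4 : (4 <= n)%N.
  rewrite -ltnS ltnNge; apply/negP => /half_pow_le /le_trans /(_ en).
  by rewrite leNgt e4.
have := covered_by_cubes_product (@digit_set_covered R S n.+1)
  (@digit_set_covered R (predC S) n.+1).
rewrite -expnD count_below_predC => /(covered_by_cubes_le en)/covering_numberP[_].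
move: (covering_number _ _) => N Nn.
have lnN : ln N%:R <= n.+1%:R * ln 2 :> R.
  have [->|N0] := posnP N; first by rewrite ln0// mulr_ge0// ltW// ln2_gt0.
  rewrite mulr_natl -lnXn// ler_ln ?posrE ?exprn_gt0 ?ltr0n//.
  by rewrite -natrX ler_nat.
have lne : n%:R * ln 2 < ln (1 / e).
  rewrite mulr_natl -lnXn// ltr_ln ?posrE ?exprn_gt0 ?divr_gt0//.
  by rewrite ltr_pdivlMr// mulrC -ltr_pdivlMr ?exprn_gt0.
have n4l : 4 * ln 2 <= n%:R * ln 2 :> R.
  by rewrite ler_wpM2r ?(ler_nat _ 4)// ltW// ln2_gt0.
move: lnN lne n4l (ln2_gt0); rewrite -[n.+1%:R]natr1 mulrDl mul1r.
move: (n%:R * ln 2 : R) => nl; move: (ln 2 : R) (ln (1 / e)) (ln N%:R : R) => l L K.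
by move=> ? ? ? ?; rewrite ler_pdivrMr; lra.
Unshelve. all: by end_near. Qed.
End MinkowskiDimension.

(** * Bounds on the Hausdorff dimension *)

Section HausdorffDimension.
Variable R : realType.
Implicit Types S : pred nat.

Lemma euclidean_dist_ge0 (k : nat) (x y : 'rV[R]_k) : 0 <= euclidean_dist x y.
Proof. exact: sqrtr_ge0. Qed.

Lemma coord_dist_le (k : nat) (x y : 'rV[R]_k) j :
  `|x 0 j - y 0 j| <= euclidean_dist x y.
Proof.
rewrite /euclidean_dist -sqrtr_sqr ler_wsqrtr// (bigD1 j)//= lerDl.
by apply: sumr_ge0 => i _; exact: sqr_ge0.
Qed.

Lemma diam_ge (k : nat) (U : set 'rV[R]_k) x y :
  U x -> U y -> ((euclidean_dist x y)%:E <= diam U)%E.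
Proof. by move=> Ux Uy; apply: ereal_sup_ubound; exists x => //; exists y. Qed.

Lemma diam_ge0 (k : nat) (U : set 'rV[R]_k) : U !=set0 -> (0 <= diam U)%E.
Proof.
by move=> [x Ux]; apply: le_trans (diam_ge Ux Ux); rewrite lee_fin euclidean_dist_ge0.
Qed.

Lemma diam_pow_ge0 (k : nat) (s : R) (U : set 'rV[R]_k) : (0 <= diam_pow s U)%E.
Proof. by rewrite /diam_pow; case: ifP => // _; exact: poweR_ge0. Qed.

Lemma diam_pow0 (k : nat) (s : R) : diam_pow s (set0 : set 'rV[R]_k) = 0%E.
Proof. by rewrite /diam_pow; case: asboolP. Qed.

Lemma diam_pow_neq0 (k : nat) (s : R) (U : set 'rV[R]_k) :
  U !=set0 -> diam_pow s U = poweR (diam U) s.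
Proof. by rewrite /diam_pow; case: asboolP => // -> []. Qed.

Lemma diam_pow_le (k : nat) (s e : R) (U : set 'rV[R]_k) : 0 <= s -> 0 <= e ->
  (diam U <= e%:E)%E -> (diam_pow s U <= (e `^ s)%:E)%E.
Proof.
move=> s0 e0 Ue; have [->|U0] := eqVneq U set0.
  by rewrite diam_pow0 lee_fin powR_ge0.
move/set0P in U0; rewrite diam_pow_neq0// -poweR_EFin.
by apply: gt0_ler_poweR => //; rewrite in_itv /= leey andbT// diam_ge0.
Qed.

Lemma hausdorff_premeasure_ge0 (k : nat) (s delta : R) (A : set 'rV[R]_k) :
  (0 <= hausdorff_premeasure s delta A)%E.
Proof.
apply: le_ereal_inf_tmp => _ [U _ <-]; apply: nneseries_ge0 => i _ _.
exact: diam_pow_ge0.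
Qed.

Lemma diam_cube1_le (c : 'rV[R]_1) (e : R) : 0 <= e -> (diam (cube c e) <= e%:E)%E.
Proof.
move=> e0; apply: ge_ereal_sup => _ [x xc [y yc <-]].
rewrite lee_fin /euclidean_dist big_ord1 sqrtr_sqr ler_norml.
by have /andP[? ?] := xc 0; have /andP[? ?] := yc 0; apply/andP; split; lra.
Qed.

(** At a sparse level at most 2^k intervals of length 2^-8k cover the set. Each contributes at most
    2^-2k for the exponent 1/4, so the total is at most 2^-k. *)
Lemma hausdorff_measure_digit_set S : sparse S ->
  hausdorff_measure (1 / 4) (digit_set R S) = 0%E.
Proof.
move=> sS; apply/eqP; rewrite eq_le; apply/andP; split; last first.
  apply: le_ereal_sup_tmp.
  exists (hausdorff_premeasure (1 / 4) 1 (digit_set R S)); first by exists 1 => /=.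
  exact: hausdorff_premeasure_ge0.
apply: ge_ereal_sup => _ [delta /= delta0 <-]; apply/lee_addgt0Pr => e e0.
rewrite add0e.
(* 2^-k must be below [delta] for the cover to be admissible and below [e] for its total to be
   small. *)
have m0 : 0 < Num.min delta e by rewrite lt_min delta0.
have [k [_ + ck]] := sparse_large sS m0; rewrite lt_min => /andP[kdelta ke].
pose r : R := 1 / 2 ^+ (8 * k).
have r0 : 0 <= r by rewrite ltW// half_pow_gt0.
have rk : r <= 1 / 2 ^+ k by apply: half_pow_le; rewrite leq_pmull.
have [c Ac] := @digit_set_covered R S (8 * k).
set N := (2 ^ _)%N in c Ac.
pose U i := oapp (fun j : 'I_N => cube (c j) r) set0 (insub i).
have diamU i : (diam (U i) <= r%:E)%E.
  rewrite /U; case: insubP => [j _ _|_] /=; first exact: diam_cube1_le.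
  by apply: ge_ereal_sup => _ [x []].
apply: ge_ereal_inf; eexists.
  exists U; last reflexivity; split => [x /Ac[i xi]|i].
    by exists i => //; rewrite /U valK.
  by apply: le_trans (diamU i) _; rewrite lee_fin (le_trans rk)// ltW.
rewrite (@nneseries_zero_tail _ _ N); first last.
- by move=> i Ni; rewrite /U insubN -?leqNgt//= diam_pow0.
- by move=> i; exact: diam_pow_ge0.
apply: (@le_trans _ _ (\sum_(i < N) (1 / 2 ^+ (2 * k))%:E)%E).
  apply: lee_sum => i _; have s0 : 0 <= 1 / 4 :> R by lra.
  apply: le_trans (diam_pow_le s0 r0 (diamU i)) _; rewrite lee_fin.
  have -> : r = (1 / 2 ^+ (2 * k)) `^ 4%:R.
    by rewrite powR_mulrn ?divr_ge0 ?exprn_ge0// /r !div1r exprVn -exprM mulnAC.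
  by rewrite -powRrM mulrCA divff// mulr1 powRr1// ltW// half_pow_gt0.
rewrite sumEFin lee_fin sumr_const card_ord -[_ *+ N]mulr_natl.
apply: le_trans (ltW ke).
rewrite mul2n -addnn exprD /N natrX !div1r invfM mulrA ler_piMl ?invr_ge0 ?exprn_ge0//.
by rewrite ler_pdivrMr ?exprn_gt0// mul1r ler_weXn2l ?ler1n.
Qed.

Lemma hausdorff_dim_digit_set_le S : sparse S ->
  (hausdorff_dim (digit_set R S) <= (1 / 4)%:E)%E.
Proof.
move=> sS; apply: ereal_inf_lbound; exists (1 / 4) => //.
by split; [lra|exact: hausdorff_measure_digit_set].
Qed.

(* [coord_sum] is 2-Lipschitz. *)
Lemma coord_sum_image_itv (U : set 'rV[R]_(1 + 1)) (D : R) : U !=set0 ->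
  (diam U <= D%:E)%E -> exists a, coord_sum (R := R) @` U `<=` `[a, a + 4 * D].
Proof.
move=> [x Ux] UD; exists (coord_sum x - 2 * D) => _ [y Uy <-].
have : euclidean_dist x y <= D by rewrite -lee_fin (le_trans (diam_ge Ux Uy)).
have := coord_dist_le x y (lshift 1 ord0); have := coord_dist_le x y (rshift 1 ord0).
rewrite /coord_sum /= in_itv /= !ler_norml => /andP[? ?] /andP[? ?] ?.
by apply/andP; split; lra.
Qed.

(** A piece of diameter D <= 1 projects into an interval of length 4D, and D <= D^s because s <= 1.
    The lengths sum to at least 1, whence the constant 1/4. *)
Lemma hausdorff_premeasure_digit_product_ge S (s : R) : 0 <= s <= 1 ->
  ((1 / 4)%:E <= hausdorff_premeasure s 1
     (cartesian_product (digit_set R S) (digit_set R (predC S))))%E.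
Proof.
move=> /andP[s0 s1]; apply: le_ereal_inf_tmp => _ [U [cU U1] <-].
pose l i : R := if `[< U i = set0 >] then 0 else 4 * fine (diam (U i)).
have fdiam i : U i !=set0 -> exists2 D, diam (U i) = D%:E & 0 <= D <= 1.
  move=> Ui; have := diam_ge0 Ui; have := U1 i.
  by case: (diam _) => // D; rewrite !lee_fin => ? ?; exists D => //; apply/andP.
have h : (1 <= \sum_(0 <= i <oo) (l i)%:E)%E.
  apply: digit_product_cover_ge1 cU => i; rewrite /l; case: asboolP => [Ui|/eqP/set0P Ui].
  - by [].
  - by have [D -> /andP[D0 _]] := fdiam i Ui; rewrite mulr_ge0.
  - by exists 0 => y [x]; rewrite Ui.
  - by have [D UD _] := fdiam i Ui; apply: coord_sum_image_itv => //; rewrite UD.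
have {}h : (1 <= 4%:E * \sum_(0 <= i <oo) diam_pow s (U i))%E.
  apply: le_trans h _; rewrite -nneseriesZl; last by move=> i _; exact: diam_pow_ge0.
  apply: lee_nneseries => i *; rewrite /l; case: asboolP => [Ui|/eqP/set0P Ui].
  - by [].
  - by have [D -> /andP[D0 _]] := fdiam i Ui; rewrite lee_fin mulr_ge0.
  - by rewrite Ui diam_pow0 mule0.
  have [D UD /andP[D0 D1]] := fdiam i Ui.
  rewrite diam_pow_neq0// UD poweR_EFin -EFinM lee_fin ler_pM2l//=.
  (* Monotonicity in the exponent is applied only to a positive base. *)
  have [->|Dneq0] := eqVneq D 0; first exact: powR_ge0.
  rewrite -[leLHS]powRr1//; apply: ger_powR => //.
  by rewrite lt0r Dneq0 D0.
by rewrite div1r -[X in (X <= _)%E]mule1 lee_pdivrMl.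
Qed.

(** An exponent s < 1 of measure zero would contradict the bound 1/4 on the premeasure at [delta] =
    1, which the measure dominates. *)
Lemma hausdorff_dim_digit_product_ge S :
  (1 <= hausdorff_dim
     (cartesian_product (digit_set R S) (digit_set R (predC S))))%E.
Proof.
apply: le_ereal_inf_tmp => _ [s [s0 Hs] <-]; rewrite lee_fin leNgt; apply/negP => s1.
have : ((1 / 4)%:E <= (0 : \bar R))%E; last by rewrite lee_fin => ?; lra.
rewrite -Hs; apply: le_ereal_sup_tmp.
exists (hausdorff_premeasure s 1
  (cartesian_product (digit_set R S) (digit_set R (predC S)))).
  by exists 1 => /=.
by apply: hausdorff_premeasure_digit_product_ge; rewrite s0 ltW.
Qed.
End HausdorffDimension.

(** * Failure of additivity for both dimensions *)

Theorem mainTheorem3 (R : realType) :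
  ~ product_summable (@upper_minkowski_dim R) /\
  ~ product_summable (@hausdorff_dim R).
Proof.
(* The Minkowski lower bound for [B] asks for sparseness of the complement of its own positions. *)
have sparseCC : sparse (predC (predC odd_blocks)).
  have -> : (predC (predC odd_blocks) : pred nat) = odd_blocks.
    by apply/funext => i /=; rewrite negbK.
  exact: sparse_odd_blocks.
pose A := digit_set R odd_blocks; pose B := digit_set R (predC odd_blocks).
split => /(_ 1 1 A B isT isT (digit_set_neq0 _ _) (@bounded_digit_set _ _)
               (digit_set_neq0 _ _) (@bounded_digit_set _ _)) eqAB.
- have := @upper_minkowski_dim_digit_product_le R odd_blocks.
  rewrite -/A -/B -[upper_minkowski_dim (cartesian_product _ _)]eqAB leNgt => /negP; apply.
  (* Here 5/4 < 3/4 + 3/4. *)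
  apply: lt_le_trans (leeD (upper_minkowski_dim_digit_set_ge R sparse_even_blocks)
                           (upper_minkowski_dim_digit_set_ge R sparseCC)).
  by rewrite -EFinD lte_fin; lra.
- have := @hausdorff_dim_digit_product_ge R odd_blocks.
  rewrite -/A -/B -[hausdorff_dim (cartesian_product _ _)]eqAB leNgt => /negP; apply.
  (* Here 1/4 + 1/4 < 1. *)
  apply: le_lt_trans (leeD (hausdorff_dim_digit_set_le R sparse_odd_blocks)
                           (hausdorff_dim_digit_set_le R sparse_even_blocks)) _.
  by rewrite -EFinD lte_fin; lra.
Qed.
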